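(* Let $\mathbb{K}$ be a nonzero commutative ring, $G$ a finite digraph and $\ell\ge1$ an integer. Then $\mathrm{MH}_{2,k}(G,\mathbb{K})=0$ for all $k>\ell$ if and only if $G$ satisfies the following property $(\mathcal{V}_\ell)$: any two shortest paths connecting the same vertices are $\ell$-shortly congruent, and any long path is $\ell$-quasi-reducible.
   Context: A digraph $G$ consists of a set of vertices and a set of arrows, which are ordered pairs of distinct vertices. A path of length $n\ge 0$ is a tuple of vertices $p=(p_0,\dots,p_n)$ such that each $(p_i,p_{i+1})$ is an arrow; $d(x,y)$ is the infimum of lengths of paths from $x$ to $y$ ($\infty$ if there are none). A path $(p_0,\dots,p_n)$ is shortest if $d(p_0,p_n)=n$, and long otherwise. A subpath of $p$ is a path $(p_i,p_{i+1},\dots,p_j)$. Two paths connect the same vertices if they have the same initial and the same terminal vertex. Magnitude homology: put $|x_0,\dots,x_n|=\sum_{i=0}^{n-1}d(x_i,x_{i+1})$. $\mathrm{MC}_{n,\ell}(G,\mathbb{K})$ is the free $\mathbb{K}$-module on tuples of vertices with $x_i\neq x_{i+1}$ and $|x_0,\dots,x_n|=\ell$; the differential is $\sum_{i=0}^n(-1)^i\partial_{n,i}$, where $\partial_{n,i}$ deletes $x_i$ if the resulting tuple still has norm $\ell$ and is $0$ otherwise. $\mathrm{MH}_{n,\ell}(G,\mathbb{K})=H_n(\mathrm{MC}_{\bullet,\ell}(G,\mathbb{K}))$. An equivalence relation $\sim$ on the set of paths is a congruence if $p\sim\tilde p$ implies that $p,\tilde p$ connect the same vertices and $qpq'\sim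 q\tilde pq'$ whenever the concatenations are defined. The $\ell$-short congruence is the minimal congruence such that any two shortest paths connecting the same two vertices at distance at most $\ell$ are equivalent. A long path is $\ell$-reducible if it contains a long subpath of length at most $\ell$. A long path is $\ell$-quasi-reducible if it is $\ell$-shortly congruent to an $\ell$-reducible path. *)

(* Defs.v *)
From HB Require Import structures.
From mathcomp Require Import all_boot all_order all_algebra.
From mathcomp Require Import boolp.

Set Implicit Arguments.
Unset Strict Implicit.
Unset Printing Implicit Defensive.

Import GRing.Theory.
Local Open Scope ring_scope.

(* A finite digraph is a finite type V with an irreflexive relation E : rel V;
   irreflexivity is a hypothesis of the theorem only. *)

Section Paths.
Variables (V : finType) (E : rel V).

(* (p_0, ..., p_n) is stored as psrc = p_0 and ptail = [:: p_1; ...; p_n]. *)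
Record dipath := Dipath {
  psrc : V;
  ptail : seq V;
  dipathP : path E psrc ptail }.

Definition ptgt (p : dipath) : V := last (psrc p) (ptail p).
Definition plen (p : dipath) : nat := size (ptail p).
Definition pverts (p : dipath) : seq V := psrc p :: ptail p.

Definition same_ends (p q : dipath) : Prop :=
  psrc p = psrc q /\ ptgt p = ptgt q.

Definition path_of_len (x y : V) (n : nat) : bool :=
  `[< exists p : dipath, [/\ psrc p = x, ptgt p = y & plen p = n] >].

(* The infimum of the lengths of paths from x to y; None stands for infinity. *)
Definition dist (x y : V) : option nat :=
  if pselect (exists n, path_of_len x y n) is left ex
  then Some (ex_minn ex) else None.

Definition shortest (p : dipath) : Prop :=
  dist (psrc p) (ptgt p) = Some (plen p).
Definition long (p : dipath) : Prop := ~ shortest p.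

Definition subpath (r p : dipath) : Prop := infix (pverts r) (pverts p).

Lemma pcat3_subproof (q p q' : dipath) :
  ptgt q = psrc p -> ptgt p = psrc q' ->
  path E (psrc q) (ptail q ++ ptail p ++ ptail q').
Proof.
move=> qp pq'; rewrite !cat_path dipathP -/(ptgt q) qp dipathP.
by rewrite -/(ptgt p) pq' dipathP.
Qed.

(* The concatenation q p q', which requires the endpoints to match. *)
Definition pcat3 (q p q' : dipath)
    (qp : ptgt q = psrc p) (pq' : ptgt p = psrc q') : dipath :=
  Dipath (pcat3_subproof qp pq').

Definition path_rel := dipath -> dipath -> Prop.

Record congruence (R : path_rel) : Prop := Congruence {
  cong_refl : forall p, R p p;
  cong_sym : forall p q, R p q -> R q p;
  cong_trans : forall p q r, R p q -> R q r -> R p r;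
  cong_ends : forall p q, R p q -> same_ends p q;
  cong_cat : forall (q p p1 q' : dipath)
    (qp : ptgt q = psrc p) (pq' : ptgt p = psrc q')
    (qp1 : ptgt q = psrc p1) (p1q' : ptgt p1 = psrc q'),
    R p p1 -> R (pcat3 qp pq') (pcat3 qp1 p1q') }.

Definition identifies_short (l : nat) (R : path_rel) : Prop :=
  forall p q d, shortest p -> shortest q -> same_ends p q ->
    dist (psrc p) (ptgt p) = Some d -> (d <= l)%N -> R p q.

(* The minimal congruence with identifies_short l, as the intersection of all
   of them. *)
Definition short_cong (l : nat) : path_rel := fun p q =>
  forall R : path_rel, congruence R -> identifies_short l R -> R p q.

Definition reducible (l : nat) (p : dipath) : Prop :=
  long p /\ exists r, [/\ subpath r p, long r & (plen r <= l)%N].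

Definition quasi_reducible (l : nat) (p : dipath) : Prop :=
  long p /\ exists q, reducible l q /\ short_cong l p q.

Definition property_V (l : nat) : Prop :=
  (forall p q, shortest p -> shortest q -> same_ends p q -> short_cong l p q)
  /\ (forall p, long p -> quasi_reducible l p).

End Paths.

Section MagnitudeHomology.
Variables (K : comNzRingType) (V : finType) (E : rel V).

Definition add_dist (a b : option nat) : option nat :=
  if (a, b) is (Some m, Some n) then Some (m + n)%N else None.

Definition mag_norm (s : seq V) : option nat :=
  if s is x :: s' then foldr add_dist (Some 0%N) (pairmap (dist E) x s')
  else Some 0%N.

(* sorted for the relation != only compares consecutive entries. *)
Definition is_mag_gen (l : nat) (s : seq V) : bool :=
  sorted (fun x y => x != y) s && (mag_norm s == Some l).

(* A tuple (x_0, ..., x_n) has n + 1 entries. *)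
Definition mag_gen (n l : nat) := {t : n.+1.-tuple V | is_mag_gen l t}.

Definition MC (n l : nat) := {ffun mag_gen n l -> K^o}.

Definition gen (n l : nat) (x : mag_gen n l) : MC n l :=
  [ffun y => (y == x)%:R].

Definition del (n : nat) (i : 'I_n.+2) (x : n.+2.-tuple V) : n.+1.-tuple V :=
  [tuple tnth x (lift i j) | j < n.+1].

(* insub gives None as soon as the shortened tuple is not a generator of norm
   l.  If it has norm l its consecutive entries are automatically distinct,
   since d(x, y) + d(y, x) > 0 for distinct x and y. *)
Definition face (n l : nat) (i : 'I_n.+2) (x : mag_gen n.+1 l) : MC n l :=
  if insub (del i (val x)) is Some y then gen y else 0.

Definition mag_diff (n l : nat) (c : MC n.+1 l) : MC n l :=
  \sum_(x : mag_gen n.+1 l) c x *: \sum_(i < n.+2) (-1) ^+ i *: face i x.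

Lemma mag_diff_is_linear (n l : nat) : linear (@mag_diff n l).
Proof.
move=> a u v; rewrite /mag_diff scaler_sumr -big_split /=.
by apply: eq_bigr => x _; rewrite !ffunE scalerDl scalerA.
Qed.

HB.instance Definition _ n l :=
  GRing.isLinear.Build K (MC n.+1 l) (MC n l) *:%R (@mag_diff n l)
    (@mag_diff_is_linear n l).

(* The differential out of degree 0 is zero. *)
Definition is_cycle (n l : nat) : pred (MC n l) :=
  match n return pred (MC n l) with
  | 0 => fun => true
  | n'.+1 => fun c => mag_diff c == 0
  end.

Lemma is_cycle_zmod_closed (n l : nat) : zmod_closed (@is_cycle n l).
Proof.
case: n => [|n]; split=> //; first by rewrite unfold_in /= linear0.
by move=> u v /eqP u0 /eqP v0; apply/eqP; rewrite linearB /= u0 v0 subr0.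
Qed.

HB.instance Definition _ n l :=
  GRing.isZmodClosed.Build (MC n l) (@is_cycle n l)
    (@is_cycle_zmod_closed n l).

Definition cycles (n l : nat) : Type := {c : MC n l | c \in @is_cycle n l}.
HB.instance Definition _ n l := SubChoice.on (cycles n l).
HB.instance Definition _ n l := [SubChoice_isSubZmodule of cycles n l by <:].

Definition is_boundary (n l : nat) : pred (cycles n l) := fun z =>
  `[< exists b : MC n.+1 l, mag_diff b = val z >].

Lemma is_boundary_zmod_closed (n l : nat) : zmod_closed (@is_boundary n l).
Proof.
split; first by apply/asboolP; exists 0; rewrite linear0 raddf0.
move=> u v /asboolP[b bu] /asboolP[c cv]; apply/asboolP.
by exists (b - c); rewrite linearB /= bu cv.
Qed.

HB.instance Definition _ n l :=
  GRing.isZmodClosed.Build (cycles n l) (@is_boundary n l)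
    (@is_boundary_zmod_closed n l).

Definition boundaries (n l : nat) : zmodClosed (cycles n l) :=
  GRing.ZmodClosed.clone (cycles n l) (@is_boundary n l) _.

(* Only the underlying abelian group of cycles modulo boundaries is recorded,
   which suffices to say that the homology module vanishes. *)
Definition MH (n l : nat) : zmodType := Quotient.quot (boundaries n l).

End MagnitudeHomology.

Arguments MH : clear implicits.
Arguments MH K {V} E n l.

(* Main.v *)
Require Import Defs.
From HB Require Import structures.
From mathcomp Require Import all_boot all_order all_algebra.
From mathcomp Require Import boolp zify.

Set Implicit Arguments.
Unset Strict Implicit.
Unset Printing Implicit Defensive.

Import GRing.Theory.

(** For vertices x and z and a degree k, the 2-generators (x, y, z) of length k
    are the vertices of a graph, in which each 3-generator (x, a, b, z) is an
    edge between a and b: its boundary is (x, a, z) - (x, b, z), where a face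
    whose length is less than k is replaced by zero.  An edge with one zero face
    therefore kills its other end.  Deleting y from (x, y, z) gives (x, z) if
    d(x, z) = k, and zero otherwise.  Thus the part of the second homology from
    x to z in degree k vanishes if and only if this graph is connected or empty,
    when d(x, z) = k, and every component of it contains a killed vertex, when
    d(x, z) < k.

    A 2-generator is the same as a path of length k cut into two geodesics, up
    to the choice of these geodesics.  The path condition and the condition on
    the graphs are then compared in both directions.

    If the path condition holds and k > l, an elementary step of the congruence
    changes a piece of length at most l < k of a path, so that it fixes an inner
    vertex at one end of this piece.  Moving the cut to this vertex stays in the
    same component unless it meets a killed vertex ([split_compare]), so
    congruent paths represent the same component ([marked_scong]).  For two
    geodesics with the same ends this gives connectedness.  In a reducible path,
    the pieces on both sides of a cut at an end of the long subpath of length at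
    most l are not both geodesic, so a vertex is killed ([V_exact]).

    If homology vanishes in all degrees above l, both halves of the path
    condition follow by induction on the length of paths.  A path property that
    is invariant under the congruence is a function on the vertices of the
    graph; if it is constant along edges and has the neutral value at killed
    vertices, it is constant on components ([exact_invariant]).  Instead of
    constructing components, the function is extended to a linear form on
    2-chains that vanishes on boundaries, and the form is evaluated on explicit
    cycles ([MH2_separates]).  The property is the congruence with a given
    geodesic for the first half, and quasi-reducibility for the second. *)

(** * Geodesics *)

Section Geodesics.
Variables (V : finType) (E : rel V).
Implicit Types (x y z : V) (s t u v a c : seq V).

Lemma path_of_lenP x y n :
  reflect (exists s, [/\ path E x s, last x s = y & size s = n])
          (path_of_len E x y n).
Proof.
apply: (iffP (asboolP _)) => [[[x' s Es] [/= <- sy sn]] | [s [Es sy sn]]].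
  by exists s.
by exists (Dipath Es).
Qed.

Lemma dist_path x y n : dist E x y = Some n ->
  exists s, [/\ path E x s, last x s = y & size s = n].
Proof.
rewrite /dist; case: pselect => // ex [<-].
by case: ex_minnP => m /path_of_lenP.
Qed.

Lemma dist_le_size x s : path E x s ->
  exists2 n, dist E x (last x s) = Some n & n <= size s.
Proof.
move=> Es; rewrite /dist; case: pselect => [ex | []]; last first.
  by exists (size s); apply/path_of_lenP; exists s.
case: ex_minnP => m _ min; exists m => //; apply: min.
by apply/path_of_lenP; exists s.
Qed.

Lemma dist_id x : dist E x x = Some 0.
Proof.
by have [n dn] := @dist_le_size x [::] isT; rewrite leqn0 dn => /eqP ->.
Qed.

Lemma dist_eq0 x y : dist E x y = Some 0 -> x = y.
Proof. by case/dist_path=> s [_ <- /size0nil ->]. Qed.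

(** Paths are handled as a vertex x together with the list s of the vertices
    after x, so that concatenation is [++] and carries no side conditions. *)
Definition geod x s : bool :=
  path E x s && (dist E x (last x s) == Some (size s)).

Lemma geod_dist x s : geod x s -> dist E x (last x s) = Some (size s).
Proof. by case/andP=> _ /eqP. Qed.

Lemma dist_geod x y n : dist E x y = Some n ->
  exists s, [/\ geod x s, last x s = y & size s = n].
Proof.
move=> d; have [s [Es sy sn]] := dist_path d.
by exists s; rewrite /geod Es sy sn d eqxx.
Qed.

Lemma geodP x s : path E x s ->
  reflect (forall t, path E x t -> last x t = last x s -> size s <= size t)
          (geod x s).
Proof.
move=> Es; apply: (iffP idP) => [/geod_dist ds t Et ts | min].
  by have [n] := dist_le_size Et; rewrite ts ds => -[<-].
have [n dn n_le] := dist_le_size Es.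
have [t [Et ts tn]] := dist_path dn.
rewrite /geod Es dn /=; apply/eqP; congr Some; apply/eqP.
by rewrite eqn_leq n_le -tn min.
Qed.

Lemma geod_swap x s t : geod x s -> path E x t -> last x t = last x s ->
  size t = size s -> geod x t.
Proof. by move=> /geod_dist ds Et ts st; rewrite /geod Et ts ds st eqxx. Qed.

Lemma geod_eq_size x s t : geod x s -> geod x t -> last x s = last x t ->
  size s = size t.
Proof. by move=> /geod_dist ds /geod_dist + st; rewrite -st ds => -[]. Qed.

(** A shortcut for a piece of a path shortens the whole path. *)
Lemma geod_cat x s t : geod x (s ++ t) -> geod x s && geod (last x s) t.
Proof.
move=> g; have /andP[Est _] := g; have := Est; rewrite cat_path => /andP[Es Et].
have min := geodP Est g.
apply/andP; split; apply/geodP => // s' Es' es'.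
  have := min (s' ++ t); rewrite cat_path Es' es' !last_cat es' !size_cat.
  by rewrite leq_add2r; apply.
have := min (s ++ s'); rewrite cat_path Es Es' !last_cat es' !size_cat.
by rewrite leq_add2l; apply.
Qed.

Lemma long_cat x a s c :
  ~~ geod (last x a) s -> ~~ geod x (a ++ s ++ c).
Proof. by apply: contra => /geod_cat/andP[_ /geod_cat/andP[]]. Qed.

Lemma path_cat3 x a s c : path E x (a ++ s ++ c) =
  [&& path E x a, path E (last x a) s & path E (last (last x a) s) c].
Proof. by rewrite !cat_path. Qed.

End Geodesics.

(** * The short congruence on vertex lists *)

Section Congruence.
Variables (V : finType) (E : rel V) (l : nat).
Implicit Types (x y z : V) (s t u v a c : seq V).

Lemma dipath_eq (p q : dipath E) :
  psrc p = psrc q -> ptail p = ptail q -> p = q.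
Proof.
case: p q => [x s Es] [y t Et] /= xy st; subst.
by congr Dipath; apply: bool_irrelevance.
Qed.

Lemma shortestE (p : dipath E) : shortest p <-> geod E (psrc p) (ptail p).
Proof.
by rewrite /geod dipathP; apply: (rwP eqP).
Qed.

Lemma longE (p : dipath E) : long p <-> ~~ geod E (psrc p) (ptail p).
Proof. by rewrite /long shortestE; split => /negP. Qed.

Lemma subpathE (r p : dipath E) : subpath r p <->
  exists a c, ptail p = a ++ ptail r ++ c /\ last (psrc p) a = psrc r.
Proof.
rewrite /subpath /pverts; split=> [/infixP[a [c]] | [a [c [pE ar]]]].
  case: a => [|x a] /= [pr pE]; first by exists [::], c.
  exists (rcons a (psrc r)), c; rewrite last_rcons pE.
  by rewrite cat_rcons.
apply/infixP; exists (belast (psrc p) a), c.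
by rewrite pE -ar -cat_cons [psrc p :: a]lastI cat_rcons.
Qed.

Lemma ptgt_pcat3 (q p q' : dipath E) (qp : ptgt q = psrc p)
  (pq' : ptgt p = psrc q') : ptgt (pcat3 qp pq') = ptgt q'.
Proof. by rewrite /ptgt /= !last_cat -/(ptgt q) qp -/(ptgt p) pq'. Qed.

Lemma short_congruence : congruence (@short_cong V E l).
Proof.
split.
- by move=> p R cR _; apply: cong_refl.
- by move=> p q pq R cR sR; apply: (cong_sym cR); apply: pq.
- move=> p q r pq qr R cR sR.
  by apply: (cong_trans cR) (qr R cR sR); apply: pq.
- pose R (p q : dipath E) := same_ends p q.
  move=> p q; apply=> [|//]; rewrite /same_ends.
  split=> [//|p1 q1 [-> ->] //|p1 q1 r [-> ->] //|//|].
  move=> q0 p0 p1 q' qp pq' qp1 p1q' [e1 e2]; split => //=.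
  by rewrite !ptgt_pcat3.
- move=> q p p1 q' qp pq' qp1 p1q' pp1 R cR sR.
  by apply: cong_cat => //; apply: pp1.
Qed.

Definition scong x s t := exists (Es : path E x s) (Et : path E x t),
  short_cong l (Dipath Es) (Dipath Et).

Lemma scong_refl x s : path E x s -> scong x s s.
Proof. by move=> Es; exists Es, Es; apply: (cong_refl short_congruence). Qed.

Lemma scong_sym x s t : scong x s t -> scong x t s.
Proof.
by case=> Es [Et st]; exists Et, Es; apply: (cong_sym short_congruence).
Qed.

Lemma scong_trans x s t u : scong x s t -> scong x t u -> scong x s u.
Proof.
case=> Es [Et st] [Et' [Eu tu]]; exists Es, Eu.
rewrite (bool_irrelevance Et' Et) in tu.
exact: (cong_trans short_congruence) st tu.
Qed.

Lemma scong_path x s t : scong x s t -> path E x s /\ path E x t.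
Proof. by case=> Es [Et _]. Qed.

Lemma scong_last x s t : scong x s t -> last x s = last x t.
Proof. by case=> Es [Et /(cong_ends short_congruence)[]]. Qed.

Lemma scong_cat x a s t c : path E x (a ++ s ++ c) -> scong (last x a) s t ->
  scong x (a ++ s ++ c) (a ++ t ++ c).
Proof.
move=> Easc st; have := Easc; rewrite path_cat3 => /and3P[Ea Es Ec].
have lst := scong_last st; case: st => Es' [Et st].
have Eatc : path E x (a ++ t ++ c) by rewrite path_cat3 Ea Et -lst.
exists Easc, Eatc; rewrite lst in Ec.
have := @cong_cat _ _ _ short_congruence (Dipath Ea) (Dipath Es')
  (Dipath Et) (Dipath Ec) erefl lst erefl erefl st.
by congr short_cong; apply: dipath_eq.
Qed.

Lemma scong_short x s t : geod E x s -> geod E x t -> last x s = last x t ->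
  size s <= l -> scong x s t.
Proof.
move=> gs gt st sl; have [/andP[Es _] /andP[Et _]] := (gs, gt).
exists Es, Et => R cR sR; apply: (sR _ _ (size s)) => //.
- exact/shortestE.
- exact/shortestE.
- exact: geod_dist.
Qed.

(** Since the short congruence is the least one, a property that survives each
    exchange of a geodesic piece of length at most l for another one survives
    the whole congruence. *)
Lemma scong_ind (P : V -> seq V -> Prop) :
    (forall x a s t c, geod E (last x a) s -> geod E (last x a) t ->
       last (last x a) s = last (last x a) t -> size s <= l ->
       P x (a ++ s ++ c) -> P x (a ++ t ++ c)) ->
  forall x s t, scong x s t -> P x s -> P x t.
Proof.
move=> step x s t [Es [Et]].
(* Quantifying over all contexts a and c makes R stable under concatenation. *)
pose R (p q : dipath E) := same_ends p q /\ forall x a c, last x a = psrc p ->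
  P x (a ++ ptail p ++ c) <-> P x (a ++ ptail q ++ c).
have cR : congruence R.
  split.
  - by move=> p; split.
  - move=> p q [[e1 e2] PE]; split=> [|y a c ay]; first by split.
    by rewrite PE ?ay ?e1.
  - move=> p q r [[e1 e2] PE] [[e3 e4] PE']; split=> [|y a c ay].
      by split; [rewrite e1 | rewrite e2].
    by rewrite PE // PE' // ay.
  - by move=> p q [].
  - move=> q p p1 q' qp pq' qp1 p1q' [[e1 e2] PE]; split=> [|y a c ay].
      by split => //=; rewrite !ptgt_pcat3.
    have := PE y (a ++ ptail q) (ptail q' ++ c); rewrite /= -!catA; apply.
    by rewrite last_cat ay.
have sR : identifies_short l R.
  move=> p q d /shortestE gp /shortestE gq [e1 e2] dd dl; split=> // y a c ay.
  have := geod_dist gp; rewrite -/(ptgt p) dd => -[sp].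
  have gq' : geod E (psrc p) (ptail q) by rewrite e1.
  have epq : last (psrc p) (ptail p) = last (psrc p) (ptail q).
    by rewrite -/(ptgt p) e2 e1.
  have spq := geod_eq_size gp gq' epq.
  by split; apply: step; rewrite ?ay -?spq -?sp.
move=> /(_ R cR sR) [_ /(_ x [::] [::] erefl)] /=.
by rewrite !cats0 => PE /PE.
Qed.

(** On long paths this is [quasi_reducible]. *)
Definition qred x s := exists a r c,
  [/\ scong x s (a ++ r ++ c), ~~ geod E (last x a) r & size r <= l].

Lemma qred_cong x s t : scong x s t -> qred x s -> qred x t.
Proof.
move=> /scong_sym ts [a [r [c [sE lr rl]]]]; exists a, r, c; split=> //.
exact: scong_trans sE.
Qed.

Lemma qred_cat x a s c : path E x (a ++ s ++ c) -> qred (last x a) s ->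
  qred x (a ++ s ++ c).
Proof.
move=> Easc [a' [r [c' [sE lr rl]]]]; exists (a ++ a'), r, (c' ++ c).
rewrite last_cat; split=> //.
by have := scong_cat Easc sE; rewrite -!catA.
Qed.

Lemma property_VE : property_V E l <->
  (forall x s t, geod E x s -> geod E x t -> last x s = last x t -> scong x s t)
  /\ (forall x s, path E x s -> ~~ geod E x s -> qred x s).
Proof.
split=> [[V1 V2] | [V1 V2]]; split.
- move=> x s t gs gt st; have [/andP[Es _] /andP[Et _]] := (gs, gt).
  by exists Es, Et; apply: V1 => //; apply/shortestE.
- move=> x s Es ls; have lp : long (Dipath Es) by apply/longE.
  have [_ [q [[_ [r [rq /longE lr rl]]] sq]]] := V2 _ lp.
  have [a [c [qE ar]]] := (subpathE _ _).1 rq.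
  exists a, (ptail r), c; have [/= qx _] := cong_ends short_congruence sq.
  rewrite -qx in ar; rewrite ar; split=> //; rewrite -qE.
  have Eq : path E x (ptail q) by rewrite qx dipathP.
  by exists Es, Eq; congr (short_cong _ _ _): sq; apply: dipath_eq.
- case=> [x s Es] [y t Et] /shortestE gs /shortestE gt [/= xy]; subst y => st.
  have [Es' [Et' stc]] := V1 _ _ _ gs gt st.
  by rewrite (bool_irrelevance Es Es') (bool_irrelevance Et Et').
- case=> [x s Es] lp; split=> //; have /longE/= ls := lp.
  have [a [r [c [[Es' [Et sc]] lr rl]]]] := V2 _ _ Es ls.
  exists (Dipath Et); split; last by rewrite (bool_irrelevance Es Es').
  have := Et; rewrite path_cat3 => /and3P[Ea Er Ec].
  split; first by apply/longE; apply: long_cat.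
  exists (Dipath Er); split; [|exact/longE|by []].
  by apply/subpathE; exists a, c.
Qed.

End Congruence.

Local Open Scope ring_scope.

(** * Generators of the magnitude complex in low degrees *)

Section Generators.
Variables (V : finType) (E : rel V).

Lemma add_someE m n : add_dist (Some m) (Some n) = Some (m + n)%N.
Proof. by []. Qed.

Lemma add_distP a b n : add_dist a b = Some n ->
  exists p q, [/\ a = Some p, b = Some q & (p + q)%N = n].
Proof. by case: a b => [p|] [q|] // [<-]; exists p, q. Qed.

Definition mid k x y z : bool := is_mag_gen E k [:: x; y; z].

Lemma hop_pos x y n : x != y -> dist E x y = Some n -> (0 < n)%N.
Proof. by case: n => // nxy /dist_eq0 xy; rewrite xy eqxx in nxy. Qed.

Lemma pos_hop x y n : dist E x y = Some n -> (0 < n)%N -> x != y.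
Proof.
by move=> + n0; apply: contraPneq => <-; rewrite dist_id => -[]; lia.
Qed.

Lemma midP k x y z : reflect (exists m n, [/\ dist E x y = Some m,
  dist E y z = Some n, (0 < m)%N, (0 < n)%N & (m + n)%N = k]) (mid k x y z).
Proof.
rewrite /mid /is_mag_gen /= andbT; apply: (iffP idP).
  case/andP=> /andP[nxy nyz] /eqP.
  case/add_distP=> m [_ [xy /add_distP[n [_ [yz [<-] <-]]] <-]].
  rewrite addn0; exists m, n; split=> //; first exact: hop_pos xy.
  exact: hop_pos yz.
case=> m [n [xy yz m0 n0 <-]].
by rewrite (pos_hop xy) // (pos_hop yz) // xy yz !add_someE addn0 /=.
Qed.

Lemma is_mag_gen2 k x z : is_mag_gen E k [:: x; z] -> dist E x z = Some k.
Proof.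
rewrite /is_mag_gen /= => /andP[_].
by case/eqP/add_distP=> m [_ [xz [<-] <-]]; rewrite addn0.
Qed.

Lemma is_mag_gen4 k x a b z : is_mag_gen E k [:: x; a; b; z] ->
  exists m1 m2 m3, [/\ dist E x a = Some m1, dist E a b = Some m2,
    dist E b z = Some m3, (m1 + (m2 + m3))%N = k &
    [/\ 0 < m1, 0 < m2 & 0 < m3]%N].
Proof.
rewrite /is_mag_gen /= andbT.
case/andP=> /and3P[nxa nab nbz] /eqP.
case/add_distP=> m1 [p [xa + <-]]; case/add_distP=> m2 [q [ab + <-]].
case/add_distP=> m3 [_ [bz [<-] <-]].
rewrite addn0; exists m1, m2, m3; split=> //; split.
- exact: hop_pos xa.
- exact: hop_pos ab.
- exact: hop_pos bz.
Qed.

Lemma gen4_is_mag k x a b z m1 m2 m3 : dist E x a = Some m1 ->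
  dist E a b = Some m2 -> dist E b z = Some m3 -> (m1 + (m2 + m3))%N = k ->
  (0 < m1)%N -> (0 < m2)%N -> (0 < m3)%N -> is_mag_gen E k [:: x; a; b; z].
Proof.
move=> xa ab bz <- p1 p2 p3.
rewrite /is_mag_gen /= (pos_hop xa) // (pos_hop ab) // (pos_hop bz) //.
by rewrite xa ab bz !add_someE addn0 /=.
Qed.

End Generators.

(** * Differentials, boundaries and the vanishing of homology *)

Section Complex.
Variables (K : comNzRingType) (V : finType) (E : rel V) (k : nat).
Notation C n := (MC K E n k).

(** A tuple that is not a generator stands for zero, as in the differential. *)
Definition basis n (t : n.+1.-tuple V) : C n :=
  if insub t is Some y then gen K y else 0.

Lemma basis_gen n (w : mag_gen E n k) : gen K w = basis (val w).
Proof. by rewrite /basis valK. Qed.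

Lemma basis_out n (t : n.+1.-tuple V) : ~~ is_mag_gen E k t -> basis t = 0.
Proof. by move=> nt; rewrite /basis insubN. Qed.

Lemma MC_sum n (c : C n) : c = \sum_w c w *: gen K w.
Proof.
apply/ffunP => w; rewrite sum_ffunE (bigD1 w) //= big1 => [|v vw].
  by rewrite !ffunE eqxx addr0 [RHS]mulr1.
by rewrite !ffunE eq_sym (negPf vw) [LHS]mulr0.
Qed.

Lemma sum_gen n (U : lmodType K) (f : mag_gen E n k -> U) (w : mag_gen E n k) :
  \sum_v gen K w v *: f v = f w.
Proof.
rewrite (bigD1 w) //= big1 => [|v vw]; rewrite ffunE.
  by rewrite eqxx scale1r addr0.
by rewrite (negPf vw) scale0r.
Qed.

Lemma mag_diff_gen n (w : mag_gen E n.+1 k) :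
  mag_diff (gen K w) = \sum_(i < n.+2) (-1) ^+ i *: basis (del i (val w)).
Proof. exact: sum_gen. Qed.

Lemma mag_diff_gens n (c : C n.+1) :
  mag_diff c = \sum_w c w *: mag_diff (gen K w).
Proof. by apply: eq_bigr => w _; rewrite mag_diff_gen. Qed.

(** Deleting an end of a generator loses a hop of positive length, so only the
    inner faces contribute, here and in degree 3. *)
Lemma mag_diff_basis2 (x y z : V) : is_mag_gen E k [:: x; y; z] ->
  mag_diff (basis [tuple x; y; z]) = - basis [tuple x; z].
Proof.
move=> g; have [m [n [xy yz m0 n0 mn]]] := midP _ _ _ _ _ g.
rewrite /basis (insubT (is_mag_gen E k \o val) (g : (_ \o _) [tuple x; y; z])).
rewrite mag_diff_gen /=.
rewrite !big_ord_recl big_ord0 /=.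
have -> : del ord0 [tuple x; y; z] = [tuple y; z].
  by apply: eq_from_tnth => j; rewrite tnth_mktuple; case: j => [[|[|]]].
have -> : del (lift ord0 ord0) [tuple x; y; z] = [tuple x; z].
  by apply: eq_from_tnth => j; rewrite tnth_mktuple; case: j => [[|[|]]].
have -> : del (lift ord0 (lift ord0 ord0)) [tuple x; y; z] = [tuple x; y].
  by apply: eq_from_tnth => j; rewrite tnth_mktuple; case: j => [[|[|]]].
rewrite (@basis_out 1 [tuple y; z]) 1?(@basis_out 1 [tuple x; y]).
- by rewrite !scaler0 add0r !addr0 expr1 scaleN1r.
- by apply/negP => /is_mag_gen2; rewrite xy => -[]; lia.
- by apply/negP => /is_mag_gen2; rewrite yz => -[]; lia.
Qed.

Lemma mag_diff_basis3 (x a b z : V) : is_mag_gen E k [:: x; a; b; z] ->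
  mag_diff (basis [tuple x; a; b; z]) =
  basis [tuple x; a; z] - basis [tuple x; b; z].
Proof.
move=> g; have [m1 [m2 [m3 [xa ab bz mk [p1 p2 p3]]]]] := is_mag_gen4 g.
pose t := [tuple x; a; b; z].
rewrite /basis (insubT (is_mag_gen E k \o val) (g : (_ \o _) t)).
rewrite mag_diff_gen /=.
rewrite !big_ord_recl big_ord0 /=.
have -> : del ord0 [tuple x; a; b; z] = [tuple a; b; z].
  by apply: eq_from_tnth => j; rewrite tnth_mktuple; case: j => [[|[|[|]]]].
have -> : del (lift ord0 ord0) [tuple x; a; b; z] = [tuple x; b; z].
  by apply: eq_from_tnth => j; rewrite tnth_mktuple; case: j => [[|[|[|]]]].
have -> : del (lift ord0 (lift ord0 ord0)) [tuple x; a; b; z] = [tuple x; a; z].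
  by apply: eq_from_tnth => j; rewrite tnth_mktuple; case: j => [[|[|[|]]]].
have -> : del (lift ord0 (lift ord0 (lift ord0 ord0))) [tuple x; a; b; z]
    = [tuple x; a; b].
  by apply: eq_from_tnth => j; rewrite tnth_mktuple; case: j => [[|[|[|]]]].
rewrite (@basis_out 2 [tuple a; b; z]) 1?(@basis_out 2 [tuple x; a; b]).
- rewrite !scaler0 add0r !addr0 expr1 scaleN1r.
  by rewrite /bump /= expr2 mulrNN mulr1 scale1r addrC.
- apply/negP => /(@midP V E k)[n1 [n2 []]]; rewrite xa ab => -[<-] [<-]; lia.
- apply/negP => /(@midP V E k)[n1 [n2 []]]; rewrite ab bz => -[<-] [<-]; lia.
Qed.

Lemma pi_eq0 n (z : cycles K E n k) :
  (\pi_(MH K E n k)%qT z == 0) = (z \in boundaries K E n k).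
Proof.
rewrite -[z in RHS]subr0 Quotient.idealrBE; congr (_ == _).
by have -> := raddf0 (\pi_(Quotient.quot (boundaries K E n k)))%qT.
Qed.

Lemma MH_eq0P n : (forall h : MH K E n.+1 k, h = 0) <->
  (forall c : C n.+1, mag_diff c = 0 -> exists b, mag_diff b = c).
Proof.
split=> [MH0 c c0 | ex h].
  have cyc : c \in @is_cycle K V E n.+1 k by apply/eqP.
  pose z : cycles K E n.+1 k := Sub c cyc.
  have /eqP := MH0 (\pi_(MH K E n.+1 k)%qT z).
  by rewrite pi_eq0 => /asboolP[b bz]; exists b; rewrite bz SubK.
rewrite -[h]reprK; apply/eqP; rewrite pi_eq0; apply/asboolP.
by apply: ex; apply/eqP; apply: (valP (repr h)).
Qed.

Definition bdry n (c : C n) := exists b : C n.+1, mag_diff b = c.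

Lemma bdry0 n : bdry (0 : C n).
Proof. by exists 0; rewrite linear0. Qed.

Lemma bdryD n (c d : C n) : bdry c -> bdry d -> bdry (c + d).
Proof. by case=> b <- [b' <-]; exists (b + b'); rewrite linearD. Qed.

Lemma bdryN n (c : C n) : bdry c -> bdry (- c).
Proof. by case=> b <-; exists (- b); rewrite linearN. Qed.

Lemma bdryZ n a (c : C n) : bdry c -> bdry (a *: c).
Proof. by case=> b <-; exists (a *: b); rewrite linearZ. Qed.

Definition ev n (F : n.+1.-tuple V -> K) (c : C n) : K :=
  \sum_(w : mag_gen E n k) c w * F (val w).

Lemma ev_is_linear n F : linear (ev F : C n -> K^o).
Proof.
move=> a u v; rewrite /ev scaler_sumr -big_split /=.
by apply: eq_bigr => w _; rewrite !ffunE mulrDl -mulrA.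
Qed.

HB.instance Definition _ n F :=
  GRing.isLinear.Build K (C n) K^o *:%R (@ev n F) (@ev_is_linear n F).

Lemma ev_basis n F (t : n.+1.-tuple V) :
  ev F (basis t) = if is_mag_gen E k t then F t else 0.
Proof.
case: ifP => [g|/negbT ng]; last by rewrite basis_out // linear0.
rewrite /basis (insubT (is_mag_gen E k \o val) g).
by rewrite /ev (@sum_gen _ K^o (fun w => F (val w))) /=.
Qed.

(** The faces may be zero: when exactly one of them is, the other is a boundary
    by itself. *)
Lemma edge_bdry (x a b z : V) : is_mag_gen E k [:: x; a; b; z] ->
  bdry (basis [tuple x; a; z] - basis [tuple x; b; z]).
Proof.
by move=> g; exists (basis [tuple x; a; b; z]); rewrite mag_diff_basis3.
Qed.

(** A predicate P on midpoints that takes the same value on the two inner faces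
    of every 3-generator from x to z, with the value false on a face that is
    zero, gives a linear form on 2-chains that kills boundaries.  When homology
    vanishes, this form kills all cycles, in particular the difference of two
    midpoints on geodesics from x to z, or a single midpoint off geodesics. *)
Lemma MH2_separates (x z : V) (P : pred V) :
    (forall c : C 2, mag_diff c = 0 -> bdry c) ->
    (forall a b, is_mag_gen E k [:: x; a; b; z] ->
       mid E k x a z && P a = mid E k x b z && P b) ->
  (forall y y', dist E x z = Some k -> mid E k x y z -> mid E k x y' z ->
     P y = P y') /\
  (forall y, dist E x z <> Some k -> mid E k x y z -> ~~ P y).
Proof.
move=> exact2 PE.
pose F (t : 3.-tuple V) : K :=
  [&& tnth t 0 == x, P (tnth t 1) & tnth t 2%:R == z]%:R.
have F0 c : bdry c -> ev F c = 0.
  case=> e <-; rewrite mag_diff_gens linear_sum big1 //= => w _.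
  rewrite linearZ /=.
  suff -> : ev F (mag_diff (gen K w)) = 0 by rewrite scaler0.
  rewrite basis_gen; case: w => t /=.
  case/tupleP: t => x' t; case/tupleP: t => a t; case/tupleP: t => b t.
  case/tupleP: t => z' t; rewrite [t]tuple0 => g.
  rewrite (_ : [tuple of _] = [tuple x'; a; b; z']); last exact: val_inj.
  rewrite mag_diff_basis3 // linearB /= !ev_basis /F !(tnth_nth x) /=.
  have [xx|] /= := eqVneq x' x; last by rewrite !if_same subrr.
  have [zz|] /= := eqVneq z' z; last by rewrite !andbF !if_same subrr.
  rewrite !andbT; rewrite xx zz in g *; have := PE a b g; rewrite /mid.
  by do 2!case: is_mag_gen => /=; do 2?[case: (P _) => //=];
     rewrite ?subrr ?subr0.
have FP y : mid E k x y z -> ev F (basis [tuple x; y; z]) = (P y)%:R.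
  move=> g; rewrite ev_basis ifT; last exact: g.
  by rewrite /F !(tnth_nth x) /= !eqxx andbT.
split=> [y y' xz gy gy' | y xz gy].
  have /F0 : bdry (basis [tuple x; y; z] - basis [tuple x; y'; z]).
    by apply: exact2; rewrite linearB /= !mag_diff_basis2 // subrr.
  rewrite linearB /= !FP //.
  by case: (P y) (P y') => -[] //= /eqP;
     rewrite ?subr0 ?sub0r ?oppr_eq0 oner_eq0.
have /F0 : bdry (basis [tuple x; y; z]).
  apply: exact2; rewrite mag_diff_basis2 // basis_out ?oppr0 //.
  by apply/negP => /is_mag_gen2.
by rewrite FP //; case: (P y) => // /eqP; rewrite oner_eq0.
Qed.

(** The converse criterion, by a contracting homotopy: h sends the generator
    (x, z) to (x, y, z) for one chosen midpoint y.  The hypotheses say that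
    c + h (d c) is a boundary for each generator c, hence for each chain c, and
    d c = 0 for a cycle. *)
Lemma MH2_exact :
    (forall x y y' z, dist E x z = Some k -> mid E k x y z -> mid E k x y' z ->
       bdry (basis [tuple x; y; z] - basis [tuple x; y'; z])) ->
    (forall x y z, dist E x z <> Some k -> mid E k x y z ->
       bdry (basis [tuple x; y; z])) ->
  forall c : C 2, mag_diff c = 0 -> bdry c.
Proof.
move=> Bedge Bkill c c0.
pose rep (w : mag_gen E 1 k) : C 2 :=
  if [pick y | mid E k (tnth (val w) 0) y (tnth (val w) 1)] is Some y
  then basis [tuple tnth (val w) 0; y; tnth (val w) 1] else 0.
pose h (e : C 1) : C 2 := \sum_w e w *: rep w.
have h_lin : linear h.
  move=> a u v; rewrite /h scaler_sumr -big_split /=.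
  by apply: eq_bigr => w _; rewrite !ffunE scalerDl scalerA.
have h0 : h 0 = 0 by rewrite /h big1 // => w _; rewrite ffunE scale0r.
have hD u v : h (u + v) = h u + h v.
  by have := h_lin 1 u v; rewrite !scale1r.
have hZ a u : h (a *: u) = a *: h u.
  by have := h_lin a u 0; rewrite !addr0 h0 addr0.
have key w : bdry (gen K w + h (mag_diff (gen K w))).
  rewrite basis_gen; case: w => t /=.
  case/tupleP: t => x t; case/tupleP: t => y t; case/tupleP: t => z t.
  rewrite [t]tuple0 => g.
  rewrite (_ : [tuple of _] = [tuple x; y; z]); last exact: val_inj.
  rewrite mag_diff_basis2 // -scaleN1r hZ scaleN1r.
  have [xz|xz] := pselect (dist E x z = Some k); last first.
    rewrite (@basis_out 1); last by apply/negP => /is_mag_gen2.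
    by rewrite h0 subr0; apply: Bkill.
  have g2 : is_mag_gen E k [tuple x; z].
    rewrite /is_mag_gen /= xz add_someE addn0 eqxx !andbT.
    have [m [n [_ _ m0 _ mn]]] := midP _ _ _ _ _ g.
    by apply: pos_hop xz _; rewrite -mn addn_gt0 m0.
  rewrite {2}/basis (insubT (is_mag_gen E k \o val) g2) /h sum_gen /rep.
  rewrite !(tnth_nth x) /=; case: pickP => [y' g'|/(_ y)/negP no].
  2: by case: no; exact: g.
  exact: Bedge.
have -> : c = c + h (mag_diff c) by rewrite c0 h0 addr0.
rewrite {1}[c]MC_sum mag_diff_gens (big_morph h hD h0) -big_split /=.
elim/big_ind: _ => [||w _]; [exact: bdry0 | exact: bdryD |].
by rewrite hZ -scalerDr; apply: bdryZ.
Qed.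

End Complex.

(** * Splitting a path into two geodesics *)

Lemma cat_eq_split (T : Type) (u v u' v' : seq T) : u ++ v = u' ++ v' ->
  (size u' <= size u)%N -> exists m, u = u' ++ m /\ v' = m ++ v.
Proof.
elim: u' u => [|x u' IH] [|y u] //= uv; [by exists [::] | by exists (y :: u) |].
by case: uv => -> /IH + le => /(_ le)[m [-> ->]]; exists m.
Qed.

Section Splittings.
Variables (V : finType) (E : rel V).
Implicit Types (x y z : V) (s t u v a c : seq V).

(** The path u ++ v from x to z represents the generator (x, y, z) of degree k
    with midpoint y = last x u. *)
Definition splits x z k u v :=
  [/\ (0 < size u)%N, (0 < size v)%N, geod E x u && geod E (last x u) v,
      size (u ++ v) = k & last x (u ++ v) = z].

Lemma splits_path x z k u v : splits x z k u v -> path E x (u ++ v).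
Proof.
by case=> _ _ /andP[/andP[Eu _] /andP[Ev _]] _ _; rewrite cat_path Eu.
Qed.

Lemma splits_mid x z k u v : splits x z k u v -> mid E k x (last x u) z.
Proof.
case=> u0 v0 /andP[gu gv] <- <-; apply/midP; exists (size u), (size v).
by rewrite (geod_dist gu) last_cat (geod_dist gv) size_cat.
Qed.

Lemma mid_splits k x y z : mid E k x y z ->
  exists u v, splits x z k u v /\ last x u = y.
Proof.
case/midP=> m [n [/dist_geod[u [gu uy um]] /dist_geod[v [gv vz vn]] m0 n0 mn]].
exists u, v; split=> //; split; rewrite ?size_cat ?um ?vn ?uy ?gu //.
by rewrite last_cat uy.
Qed.

Lemma mid_split_geod k x u v : path E x (u ++ v) -> size (u ++ v) = k ->
  geod E x u || geod E (last x u) v -> mid E k x (last x u) (last x (u ++ v)) ->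
  geod E x u && geod E (last x u) v.
Proof.
rewrite cat_path last_cat size_cat => /andP[Eu Ev] uvk g.
case/midP=> m [n [xu uv _ _ mn]]; move: g; rewrite /geod Eu Ev xu uv /=.
by case/orP=> /eqP[e]; apply/andP; split; apply/eqP; congr Some; lia.
Qed.

Lemma geod3_gen k x a s c : geod E x a -> geod E (last x a) s ->
  geod E (last (last x a) s) c -> (0 < size a)%N -> (0 < size s)%N ->
  (0 < size c)%N -> size (a ++ s ++ c) = k ->
  is_mag_gen E k [:: x; last x a; last (last x a) s; last x (a ++ s ++ c)].
Proof.
move=> ga gs gc a0 s0 c0 <-; rewrite !last_cat !size_cat.
by apply: gen4_is_mag (geod_dist ga) (geod_dist gs) (geod_dist gc) _ _ _ _.
Qed.

End Splittings.

(** * The path condition forces homology to vanish *)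

Section Sufficiency.
Variables (K : comNzRingType) (V : finType) (E : rel V) (k l : nat).
Implicit Types (x y z : V) (r s t u v a c : seq V).
Notation mark x y z := (basis K E k [tuple x; y; z]).

(** Two distinct cut points and the ends of the path form a 3-generator.  If the
    new cut is again a splitting into geodesics, this makes the two midpoints
    homologous; otherwise the face of the new cut is zero, and the old midpoint
    bounds. *)
Lemma split_compare x z u v u' v' : splits E x z k u v -> u ++ v = u' ++ v' ->
    (0 < size u')%N -> (0 < size v')%N ->
  splits E x z k u' v' /\ bdry (mark x (last x u) z - mark x (last x u') z)
  \/ ~~ geod E x (u ++ v) /\ bdry (mark x (last x u) z).
Proof.
move=> sp uv u0' v0'; have Ep := splits_path sp.
case: sp => u0 v0 /andP[gu gv] uvk uvz.
have [uu|uu] := eqVneq (size u) (size u').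
  have [m [um vm]] := cat_eq_split uv (eq_leq (esym uu)).
  have m0 : m = [::] by apply: size0nil; move: uu; rewrite um size_cat; lia.
  subst; rewrite /= cats0 in gu gv *; left; rewrite subrr.
  split; last exact: bdry0.
  by split=> //; rewrite ?gu.
have [leu|leu] := leqP (size u') (size u).
  have [m [um vm]] := cat_eq_split uv leu; subst u v'.
  have m0 : (0 < size m)%N by move: uu; rewrite size_cat; lia.
  have /andP[gu' gm] := geod_cat gu; rewrite -catA in Ep uvk uvz *.
  rewrite last_cat in gv.
  have B := edge_bdry K (geod3_gen gu' gm gv u0' m0 v0 uvk).
  rewrite uvz -last_cat in B.
  have [gmv|lmv] := boolP (geod E (last x u') (m ++ v)).
    left; split; last by have := bdryN B; rewrite opprB.
    by split=> //; rewrite gu'.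
  right; split; first by apply: contra lmv => /geod_cat/andP[].
  rewrite [X in X - _]basis_out ?sub0r in B; last first.
    apply: contra lmv; rewrite -uvz => /(mid_split_geod Ep uvk).
    by rewrite gu' => /(_ isT).
  by have := bdryN B; rewrite opprK.
have [m [um vm]] := cat_eq_split (esym uv) (ltnW leu); subst u' v.
have m0 : (0 < size m)%N by move: uu; rewrite size_cat; lia.
have /andP[gm gv'] := geod_cat gv.
have B := edge_bdry K (geod3_gen gu gm gv' u0 m0 v0' uvk).
rewrite uvz -last_cat in B; rewrite -last_cat in gv'.
have [gum|lum] := boolP (geod E x (u ++ m)).
  by left; split=> //; split; rewrite -?catA // gum.
right; split; first by apply: contra lum; rewrite catA => /geod_cat/andP[].
rewrite [X in _ - X]basis_out ?subr0 // in B.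
apply: contra lum; rewrite -uvz catA; rewrite catA in Ep uvk.
by move/(mid_split_geod Ep uvk); rewrite gv' orbT => /(_ isT)/andP[].
Qed.

(** The invariant transported along the short congruence; it can be lost only if
    y is killed. *)
Definition marked y z x r := exists u v, [/\ r = u ++ v, splits E x z k u v &
  bdry (mark x y z - mark x (last x u) z)].

(** A midpoint on a geodesic is not a cycle, so it never bounds; the condition
    on the distance keeps this information. *)
Definition killed x y z := bdry (mark x y z) /\ dist E x z <> Some k.

Lemma marked_move x y z r u v : marked y z x r -> r = u ++ v ->
    (0 < size u)%N -> (0 < size v)%N ->
  splits E x z k u v /\ bdry (mark x y z - mark x (last x u) z)
  \/ killed x y z /\ ~~ geod E x r.
Proof.
case=> u1 [v1 [rE sp B]] uv u0 v0; subst r.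
have [[sp' B']|[lr B']] := split_compare sp uv u0 v0.
  by left; split=> //; have := bdryD B B'; rewrite addrA subrK.
right; split; rewrite -?uv //; split.
  by have := bdryD B B'; rewrite subrK.
have Ep := splits_path sp; case: sp => _ _ _ uvk uvz.
by apply/eqP; move: lr; rewrite /geod Ep uvk uvz.
Qed.

Hypothesis lk : (l < k)%N.

(** An elementary exchange concerns a piece of length at most l < k, so a
    nonempty piece starts or ends at an inner vertex.  Moving the splitting to
    that vertex puts the piece inside one of the two geodesics, where the
    exchange is harmless. *)
Lemma marked_scong x y z s t : scong E l x s t -> marked y z x s ->
  marked y z x t \/ killed x y z.
Proof.
move=> st ms; pose P x s := marked y z x s \/ killed x y z.
apply: (@scong_ind _ _ _ P _ _ _ _ st); last by left.
move=> {}x a {ms st}s {}t c gs gt lst sl [m|]; last by right.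
have szst := geod_eq_size gs gt lst.
have [s0|s0] := posnP (size s).
  left; rewrite (size0nil (etrans (esym szst) s0)).
  by rewrite (size0nil s0) in m.
have ask : size (a ++ s ++ c) = k by case: m => u [v [-> [_ _ _ <-]]].
rewrite !size_cat in ask.
have /andP[Et _] := gt.
have [a0|a0] := posnP (size a).
  have [||[sp B]|[kill _]] := marked_move m (catA a s c).
  - by rewrite size_cat; lia.
  - by lia.
  2: by right.
  left; exists (a ++ t), c; rewrite catA last_cat -lst -last_cat; split=> //.
  case: sp => _ c0 /andP[gas gc]; rewrite !size_cat -catA => e1 e2.
  split; rewrite ?size_cat -?szst -?catA -?e2 ?last_cat -?lst //; try lia.
  rewrite -last_cat gc andbT; apply: (geod_swap gas).
  - by have /andP[] := gas; rewrite !cat_path => /andP[-> _].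
  - by rewrite !last_cat lst.
  - by rewrite !size_cat szst.
have [||[sp B]|[kill _]] := marked_move m (erefl (a ++ s ++ c)).
- by [].
- by rewrite size_cat; lia.
2: by right.
left; exists a, (t ++ c); split=> //.
case: sp => _ _ /andP[ga gsc]; rewrite !size_cat => e1 e2.
split; rewrite ?size_cat -?szst -?e2 ?last_cat -?lst //; try lia.
rewrite ga /=; apply: (geod_swap gsc).
- by have /andP[] := gsc; rewrite !cat_path Et lst => /andP[].
- by rewrite !last_cat lst.
- by rewrite !size_cat szst.
Qed.

Lemma marked_self x z u v : splits E x z k u v ->
  marked (last x u) z x (u ++ v).
Proof. by move=> sp; exists u, v; rewrite subrr; split=> //; apply: bdry0. Qed.

(** Midpoints of geodesics: congruent geodesics carry the invariant from one
    midpoint to the other.  Midpoints off geodesics: a congruent path contains a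
    long piece of length at most l < k, and a splitting at an end of this piece
    cannot be geodesic, so that the midpoint bounds. *)
Lemma V_exact :
    (forall x s t, geod E x s -> geod E x t -> last x s = last x t ->
       scong E l x s t) ->
    (forall x s, path E x s -> ~~ geod E x s -> qred E l x s) ->
  forall c : MC K E 2 k, mag_diff c = 0 -> bdry c.
Proof.
move=> V1 V2; apply: MH2_exact => [x y y' z xz|x y z xz].
  move=> /mid_splits[u [v [sp <-]]] /mid_splits[u' [v' [sp' <-]]].
  have geod_sp u1 v1 : splits E x z k u1 v1 -> geod E x (u1 ++ v1).
    move=> sp1; rewrite /geod (splits_path sp1) /=.
    by case: sp1 => _ _ _ -> ->; rewrite xz.
  have st : scong E l x (u ++ v) (u' ++ v').
    apply: V1; try exact: geod_sp.
    by case: sp => _ _ _ _ ->; case: sp' => _ _ _ _ ->.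
  case: (marked_scong st (marked_self sp)) => [m|[_ /(_ xz)] //].
  have [u0 v0 _ _ _] := sp'.
  by have [[]|[[_ /(_ xz)]]] := marked_move m erefl u0 v0.
move=> /mid_splits[u [v [sp <-]]].
have [|a [r [c [st lr rl]]]] := V2 _ _ (splits_path sp).
  by apply/negP => /geod_dist; case: sp => _ _ _ -> ->.
case: (marked_scong st (marked_self sp)) => [m|[] //].
have ark : size (a ++ r ++ c) = k by case: m => u1 [v1 [-> [_ _ _ <-]]].
rewrite !size_cat in ark.
have r0 : (0 < size r)%N by case: (r) lr => //; rewrite /geod dist_id.
have [a0|a0] := posnP (size a).
  have [||[sp' _]|[[]//]] := marked_move m (catA a r c).
  - by rewrite size_cat; lia.
  - by lia.
  by case: sp' lr => _ _ /andP[/geod_cat/andP[_ ->]].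
have [||[sp' _]|[[]//]] := marked_move m (erefl (a ++ r ++ c)).
- by [].
- by rewrite size_cat; lia.
by case: sp' lr => _ _ /andP[_ /geod_cat/andP[->]].
Qed.

End Sufficiency.

(** * Vanishing homology forces the path condition *)

Section Necessity.
Variables (K : comNzRingType) (V : finType) (E : rel V) (l : nat).
Implicit Types (x y z : V) (s t u v a c : seq V).

(** The engine of both inductions.  Since shorter geodesics with the same ends
    are congruent, an invariant Q of the congruence depends only on the midpoint
    of a splitting, and its failure is a predicate on midpoints.  The last
    hypothesis covers the paths through 3-generators with a zero face: there the
    remaining face must carry the value false in [MH2_separates]. *)
Lemma exact_invariant k x z (Q : seq V -> Prop) :
    (forall c : MC K E 2 k, mag_diff c = 0 -> bdry c) ->
    (forall x s t, geod E x s -> geod E x t -> last x s = last x t ->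
       (size s < k)%N -> scong E l x s t) ->
    (forall s t, scong E l x s t -> Q s -> Q t) ->
    (forall a s c, path E x (a ++ s ++ c) -> size (a ++ s ++ c) = k ->
       last x (a ++ s ++ c) = z -> (0 < size a)%N -> (0 < size c)%N ->
       ~~ geod E x (a ++ s) \/ ~~ geod E (last x a) (s ++ c) ->
       Q (a ++ s ++ c)) ->
  (forall u v u' v', dist E x z = Some k -> splits E x z k u v ->
     splits E x z k u' v' -> Q (u ++ v) -> Q (u' ++ v')) /\
  (forall u v, dist E x z <> Some k -> splits E x z k u v -> Q (u ++ v)).
Proof.
move=> ex sh Qc Ql.
have Qvia u v u' v' : splits E x z k u v -> splits E x z k u' v' ->
    last x u = last x u' -> Q (u ++ v) -> Q (u' ++ v').
  move=> sp sp' uu; apply: Qc; have Ep := splits_path sp.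
  case: sp sp' => u0 v0 /andP[gu gv] k1 z1 [u0' v0' /andP[gu' gv'] k2 z2].
  rewrite -uu in gv'; rewrite !last_cat in z1 z2; rewrite !size_cat in k1 k2.
  have su : scong E l x u u' by apply: sh => //; lia.
  have sv : scong E l (last x u) v v'.
    by apply: sh => //; [rewrite z1 -z2 uu | lia].
  apply: (scong_trans (scong_cat (a := [::]) Ep su)).
  rewrite uu in sv; have Ep' : path E x (u' ++ v ++ [::]).
    by have [_ +] := scong_path (scong_cat (a := [::]) Ep su); rewrite /= cats0.
  by have := scong_cat Ep' sv; rewrite !cats0.
pose P : pred V := fun y =>
  `[< exists u v, [/\ splits E x z k u v, last x u = y & ~ Q (u ++ v)] >].
have Psp u v : splits E x z k u v -> P (last x u) = `[< ~ Q (u ++ v) >].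
  move=> sp; apply/asboolP/asboolP => [[u' [v' [sp' uu nQ]]] q|nQ].
    by apply: nQ; apply: Qvia q.
  by exists u, v.
have PE (a b : V) : is_mag_gen E k [:: x; a; b; z] ->
    mid E k x a z && P a = mid E k x b z && P b.
  case/is_mag_gen4=> m1 [m2 [m3]].
  case=> /dist_geod[s1 [g1 <- e1]] /dist_geod[s2 [g2 <- e2]].
  case/dist_geod=> s3 [g3 e3 <-]; subst m1 m2 => ek [p1 p2 p3].
  have Ep : path E x (s1 ++ s2 ++ s3).
    have [/andP[E1 _] /andP[E2 _] /andP[E3 _]] := And3 g1 g2 g3.
    by rewrite path_cat3 E1 E2.
  have Ek : size (s1 ++ s2 ++ s3) = k by rewrite !size_cat.
  have ez : last x (s1 ++ s2 ++ s3) = z by rewrite !last_cat.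
  (* Both sides say that Q fails on the path through a and b. *)
  transitivity (`[< ~ Q (s1 ++ s2 ++ s3) >]).
    have [g|ng] := boolP (geod E (last x s1) (s2 ++ s3)).
      have sp : splits E x z k s1 (s2 ++ s3).
        by split; rewrite ?g1 ?size_cat //; lia.
      by rewrite (splits_mid sp) (Psp _ _ sp).
    rewrite (_ : mid _ _ _ _ _ = false); last first.
      apply: contraNF ng; rewrite -ez => /(mid_split_geod Ep Ek).
      by rewrite g1 => /(_ isT)/andP[].
    by apply/esym/negbTE/asboolPn; rewrite notK; apply: Ql => //; right.
  rewrite -last_cat in g3 *.
  have [g|ng] := boolP (geod E x (s1 ++ s2)).
    have sp : splits E x z k (s1 ++ s2) s3.
      by split; rewrite -?catA ?g ?size_cat //; lia.
    by rewrite (splits_mid sp) (Psp _ _ sp) catA.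
  rewrite (_ : mid _ _ _ _ _ = false); last first.
    apply: contraNF ng; rewrite catA in Ep Ek ez *.
    rewrite -ez => /(mid_split_geod Ep Ek).
    by rewrite g3 orbT => /(_ isT)/andP[].
  by apply/negbTE/asboolPn; rewrite notK; apply: Ql => //; left.
have [sep1 sep2] := MH2_separates ex PE.
split=> [u v u' v' xz sp sp' q | u v xz sp].
  have := sep1 _ _ xz (splits_mid sp) (splits_mid sp').
  rewrite (Psp _ _ sp) (Psp _ _ sp') => e; apply: contrapT => nq.
  have : `[< ~ Q (u' ++ v') >] by apply/asboolP.
  by rewrite -e => /asboolP.
have := sep2 _ xz (splits_mid sp); rewrite (Psp _ _ sp) => /asboolPn.
by rewrite notK.
Qed.

Hypothesis l0 : (1 <= l)%N.
Hypothesis ex : forall k, (l < k)%N ->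
  forall c : MC K E 2 k, mag_diff c = 0 -> bdry c.

(** Induction on the length: in length k > l, take for Q the congruence with s.
    A path of length k between the ends of s is itself a geodesic, so that it
    contains no long piece. *)
Lemma exact_geod_scong x s t :
  geod E x s -> geod E x t -> last x s = last x t -> scong E l x s t.
Proof.
have [k] := ubnP (size s); elim: k => // k IH in x s t *.
rewrite ltnS leq_eqVlt => /orP[/eqP sk|]; last exact: IH.
move=> gs gt st; have [sl|ls] := leqP (size s) l; first exact: scong_short.
have tk := geod_eq_size gs gt st; rewrite sk in ls tk.
have lk : (1 < k)%N by apply: leq_ltn_trans ls.
have dk : dist E x (last x s) = Some k by rewrite (geod_dist gs) sk.
have sh x0 s0 t0 : geod E x0 s0 -> geod E x0 t0 -> last x0 s0 = last x0 t0 ->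
    (size s0 < k)%N -> scong E l x0 s0 t0 by move=> *; apply: IH.
have Ql a r c : path E x (a ++ r ++ c) -> size (a ++ r ++ c) = k ->
    last x (a ++ r ++ c) = last x s -> (0 < size a)%N -> (0 < size c)%N ->
    ~~ geod E x (a ++ r) \/ ~~ geod E (last x a) (r ++ c) ->
    scong E l x s (a ++ r ++ c).
  move=> Ep pk ps _ _.
  have gp : geod E x (a ++ r ++ c) by rewrite /geod Ep ps dk pk /=.
  have /andP[_ grc] := geod_cat gp; rewrite catA in gp.
  by have /andP[gar _] := geod_cat gp; rewrite gar grc; case.
have [inv _] := exact_invariant (ex ls) sh
  (fun s' t' st' ss' => scong_trans ss' st') Ql.
have split1 x0 z0 w : geod E x0 w -> size w = k -> last x0 w = z0 ->
    exists u v, splits E x0 z0 k u v /\ u ++ v = w.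
  case: w => [|y w] gw wk wz; first by rewrite -wk in lk.
  exists [:: y], w; split=> //; split=> //.
  2: exact: (@geod_cat _ _ _ [:: y]).
  by rewrite -wk in lk.
have [u [v [sp us]]] := split1 _ _ _ gs sk erefl.
have [u' [v' [sp' ut]]] := split1 _ _ _ gt (esym tk) (esym st).
rewrite -ut; apply: (inv _ _ _ _ dk sp sp'); rewrite us.
by apply: scong_refl; case/andP: gs.
Qed.

(** Induction on the length: a path of length k > l with a shorter long piece is
    settled by that piece.  Otherwise it splits into two geodesics after its
    first arrow, with a midpoint off geodesics, and quasi-reducibility can be
    taken for Q. *)
Lemma exact_long_qred x s : path E x s -> ~~ geod E x s -> qred E l x s.
Proof.
have [k] := ubnP (size s); elim: k => // k IH in x s *.
rewrite ltnS leq_eqVlt => /orP[/eqP sk|]; last exact: IH.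
move=> Es ls; have [sl|ks] := leqP (size s) l.
  by exists [::], s, [::]; rewrite /= cats0; split=> //; apply: scong_refl.
rewrite sk in ks; have lk : (1 < k)%N by apply: leq_ltn_trans ks.
case: s => [|y s] in sk Es ls *; first by rewrite -sk in lk.
have s0 : (0 < size s)%N by rewrite -sk in lk.
have [g1|l1] := boolP (geod E x [:: y]); last first.
  apply: (@qred_cat _ _ _ x [::] [:: y] s) => //.
  by apply: IH => //; move: Es => /= /andP[->].
have [g2|l2] := boolP (geod E y s); last first.
  have Es' : path E x ([:: y] ++ s ++ [::]) by rewrite cats0.
  have := qred_cat Es'; rewrite cats0; apply.
  by apply: IH => //=; [rewrite -sk | move: Es => /= /andP[]].
have sp : splits E x (last y s) k [:: y] s by split; rewrite ?g1.
have Ql a r c : path E x (a ++ r ++ c) -> size (a ++ r ++ c) = k ->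
    last x (a ++ r ++ c) = last y s -> (0 < size a)%N -> (0 < size c)%N ->
    ~~ geod E x (a ++ r) \/ ~~ geod E (last x a) (r ++ c) ->
    qred E l x (a ++ r ++ c).
  move=> Ep; rewrite !size_cat => pk _ a0 c0.
  have := Ep; rewrite path_cat3 => /and3P[Ea Er Ec] [lar|lrc].
    rewrite catA; apply: (@qred_cat _ _ _ x [::]); first by rewrite /= -catA.
    by apply: IH => //; [rewrite size_cat; lia | rewrite cat_path Ea].
  rewrite -[r ++ c]cats0; apply: qred_cat; first by rewrite cats0.
  by apply: IH => //; [rewrite size_cat; lia | rewrite cat_path Er].
have [_ inv] := exact_invariant (ex ks)
  (fun x s t gs gt st _ => exact_geod_scong gs gt st)
  (fun s' t' st' => qred_cong st') Ql.
apply: (inv [:: y] s _ sp) => xz.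
by move: ls; rewrite /geod Es /= xz -sk /= eqxx.
Qed.

End Necessity.

Theorem theorem4p10 (K : comNzRingType) (V : finType) (E : rel V)
    (irrE : irreflexive E) (l : nat) (hl : (1 <= l)%N) :
  (forall k : nat, (l < k)%N -> forall h : MH K E 2 k, h = 0)
  <-> property_V E l.
Proof.
split=> [MH0 | /property_VE[V1 V2] k lk].
  have ex k : (l < k)%N -> forall c : MC K E 2 k, mag_diff c = 0 -> bdry c.
    by move=> lk; apply/MH_eq0P/MH0.
  apply/property_VE; split; first exact: exact_geod_scong hl ex.
  exact: exact_long_qred hl ex.
by apply/MH_eq0P; apply: V_exact lk V1 V2.
Qed.
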